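(* For every positive integer $k$ there exist a constant $K_k>0$ and an integer $n_k$, both depending only on $k$, such that for every integer $n\ge n_k$ there exists a set of positive integers $A$ with $A\in C_k(n)$, $A\not\subseteq E_k(n)$ and $$|E_k(n)|-|A|\le K_k\,\frac{n}{\log\log n}.$$
   Context: Let $p_i$ denote the $i$th prime. For positive integers $k,n$: $C_k(n)$ is the family of all subsets $A\subseteq\{1,2,\ldots,n\}$ that do not contain $k+1$ (distinct) pairwise coprime integers; $E_k(n)$ is the set of positive integers not exceeding $n$ that are divisible by at least one of $p_1,\ldots,p_k$; $|A|$ denotes the number of elements of $A$. *)

(* Defs.v *)
From mathcomp Require Import all_boot all_order all_algebra finmap.
From mathcomp Require Import all_classical all_reals all_analysis.

Set Implicit Arguments.
Unset Strict Implicit.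
Unset Printing Implicit Defensive.

Lemma ex_prime_above (m : nat) : exists p, (m < p) && prime p.
Proof. by case: (prime_above m) => p ltmp prp; exists p; rewrite ltmp. Qed.

Definition next_prime (m : nat) : nat := ex_minn (ex_prime_above m).

(* One-based: ith_prime 1 = 2, ith_prime 2 = 3; ith_prime 0 = 0 is a dummy. *)
Definition ith_prime (i : nat) : nat := iter i next_prime 0.

Local Open Scope fset_scope.

Definition pairwise_coprime (B : {fset nat}) : Prop :=
  forall x y, x \in B -> y \in B -> x != y -> coprime x y.

Definition C_family (k n : nat) (A : {fset nat}) : Prop :=
  A `<=` [fset x in iota 1 n] /\
  ~ exists B : {fset nat},
      [/\ B `<=` A, #|` B| = k.+1 & pairwise_coprime B].

Definition E_set (k n : nat) : {fset nat} :=
  [fset x in iota 1 n | has (fun i => ith_prime i %| x) (iota 1 k)].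

(* Main.v *)
(** With [p_1, ..., p_k] the first [k] primes and [m] the product of the other
    primes up to [y], take for [A] the number [m] together with the elements of
    [E_k(n)] that are not coprime to [m].  By the pigeonhole principle, [k + 1]
    pairwise coprime elements of [A] cannot all lie in [E_k(n)], so [m] is one
    of them, and no other element of [A] is coprime to [m].  The loss is at most
    the number of [x <= n] coprime to [m], hence at most [2 n phi(m) / m] when
    [m <= n].  By Euler's product, [m / phi(m)] is at least a constant
    (depending on [k]) times [ln (y + 1)].  The largest [y] with [y ^ y <= n]
    satisfies [(y + 1) ^ 2 > ln n], so [ln (y + 1) > ln (ln n) / 2]. *)
Require Import Defs.
From mathcomp Require Import all_boot all_order all_algebra finmap.
From mathcomp Require Import all_classical all_reals all_analysis.
From mathcomp Require Import ring lra.
Import Order.TTheory GRing.Theory Num.Theory.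
Local Open Scope ring_scope.

(** * Pigeonhole for pairwise coprime sets; counting integers coprime to [m] *)

Lemma prime_ith_prime (i : nat) : (0 < i)%N -> prime (ith_prime i).
Proof.
case: i => // i _; rewrite /ith_prime iterS /next_prime.
by case: ex_minnP => p /andP[].
Qed.

(** Sending [x] to the first prime of [s] dividing it is injective on [B], because distinct elements
    of [B] share no prime factor. *)
Lemma card_pairwise_coprime_le (s : seq nat) (B : {fset nat}) :
    all prime s -> (forall x, x \in B -> has (fun p => p %| x)%N s) ->
  pairwise_coprime B -> (#|` B|%fset <= size s)%N.
Proof.
move=> s_prime Bs Bco; pose f x := nth 0%N s (find (fun p => p %| x)%N s).
have fs x : x \in B -> f x \in s by move=> /Bs; rewrite has_find; apply: mem_nth.
have fdvd x : x \in B -> (f x %| x)%N by move=> /Bs /(nth_find 0%N).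
have f_inj : {in (B : seq nat) &, injective f}.
  move=> x y xB yB fxy; apply/eqP; apply: contraT => /(Bco x y xB yB).
  rewrite /coprime => /eqP gxy; have /(allP s_prime) := fs x xB.
  have : (f x %| gcdn x y)%N by rewrite dvdn_gcd fdvd //= fxy fdvd.
  by rewrite gxy dvdn1 => /eqP ->.
rewrite -(size_map f (B : seq nat)); apply: uniq_leq_size.
  by rewrite map_inj_in_uniq ?fset_uniq.
by move=> _ /mapP[x xB ->]; apply: fs.
Qed.

Lemma sum_coprime_blocks (m q : nat) :
  (\sum_(0 <= d < q * m) coprime m d = q * totient m)%N.
Proof.
elim: q => [|q IHq]; first by rewrite !mul0n big_nil.
rewrite !mulSn addnC (big_cat_nat (leq0n _) (leq_addr _ _)) /= IHq addnC.
congr addn; rewrite totient_count_coprime -{1}[(q * m)%N]add0n big_addn addKn.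
by apply: eq_bigr => d _; rewrite /coprime addnC gcdnMDl.
Qed.

(** The interval is covered by [n %/ m + 1] blocks of length [m], each containing [totient m]
    integers coprime to [m]; their total length is at most [n + m <= 2 * n]. *)
Lemma count_coprime_le (m n : nat) : (0 < m <= n)%N ->
  (count (coprime m) (iota 1 n) * m <= 2 * n * totient m)%N.
Proof.
move=> /andP[m0 mn]; pose q := (n %/ m).+1.
have nq : (n.+1 <= q * m)%N by rewrite -ltn_divLR.
have -> : count (coprime m) (iota 1 n) = (\sum_(1 <= d < n.+1) coprime m d)%N.
  rewrite -sum1_count /index_iota subSS subn0 big_mkcond /=.
  by apply: eq_bigr => d _; case: coprime.
have le_sum : (\sum_(1 <= d < n.+1) coprime m d <= q * totient m)%N.
  rewrite -sum_coprime_blocks (big_cat_nat (leq0n _) nq) /=.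
  by rewrite [X in (_ <= X + _)%N]big_ltn // -addnA addnCA leq_addr.
apply: (leq_trans (leq_mul le_sum (leqnn m))).
rewrite mulnAC leq_mul2r mul2n -addnn mulSn; apply/orP; right.
by rewrite leq_add // leq_divM.
Qed.

Lemma prime_dvd_prod_mem (p : nat) (s : seq nat) : prime p -> all prime s ->
  (p %| \prod_(q <- s) q)%N -> p \in s.
Proof.
move=> p_pr /allP s_pr; rewrite (Euclid_dvd_prod _ _ _ p_pr) big_has.
by move=> /hasP[q qs]; rewrite dvdn_prime2 ?(s_pr q) // => /eqP ->.
Qed.

(** * Euler's product and the harmonic sum *)

Section EulerProduct.
Variable R : realType.
Implicit Types (s : seq nat) (p : nat).

Definition euler_factor p : R := p%:R / p.-1%:R.

Definition euler_prod s : R := \prod_(p <- s) euler_factor p.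

Lemma euler_factor_gt0 p : prime p -> 0 < euler_factor p.
Proof.
by move=> /prime_gt1 p1; rewrite divr_gt0 // ltr0n; case: p p1 => [|[]].
Qed.

Lemma euler_prod_gt0 s : all prime s -> 0 < euler_prod s.
Proof.
move=> /allP sP; rewrite /euler_prod big_seq; apply: prodr_gt0 => p /sP.
exact: euler_factor_gt0.
Qed.

(** Multiplicativity of the totient gives [m / phi(m)] as a product of [p / (p - 1)], stated here
    without dividing by the totient. *)
Lemma totient_euler_prod s : all prime s -> uniq s ->
  (totient (\prod_(p <- s) p))%:R * euler_prod s = (\prod_(p <- s) p)%:R.
Proof.
rewrite /euler_prod; elim: s => [|p s IHs]; first by rewrite !big_nil mulr1.
move=> /= /andP[p_pr s_pr] /andP[ps s_uniq]; rewrite !big_cons.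
have co_p : coprime p (\prod_(q <- s) q).
  by rewrite prime_coprime //; apply: contra ps; apply: prime_dvd_prod_mem.
rewrite totient_coprime // totient_prime // !natrM -IHs // /euler_factor.
have p1 : p.-1%:R != 0 :> R by rewrite pnatr_eq0; case: p p_pr {ps co_p} => [|[]].
by rewrite mulrACA mulrC mulrA mulrCA; field.
Qed.

(* Splitting off the multiples of [p], the smooth sums [F] of [p :: s] and [G]
   of [s] satisfy [F <= G + F / p]. *)
Lemma smooth_harmonic_le s (N : nat) : all prime s ->
  \sum_(1 <= j < N.+1 | all [in s] (primes j)) j%:R^-1 <= euler_prod s.
Proof.
rewrite /euler_prod; elim: s => [_|p s IHs /= /andP[p_pr s_pr]].
  rewrite big_nil; case: N => [|N]; first by rewrite big_geq.
  (* Only [j = 1] contributes: for [j > 1], [pdiv j] is a prime factor outside the empty list. *)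
  rewrite big_ltn_cond //= big_nat_cond big1 ?addr0 ?invr1 // => j.
  move=> /andP[/andP[j1 _] /allP/(_ (pdiv j))].
  by rewrite pi_pdiv j1 => /(_ isT).
pose smooth (q : seq nat) j := all [in q] (primes j).
pose F := \sum_(1 <= j < N.+1 | smooth (p :: s) j) j%:R^-1 : R.
have p_gt0 := prime_gt0 p_pr.
have p0 : 0 < p%:R :> R by rewrite ltr0n.
have F_nondvd : \sum_(1 <= j < N.+1 | smooth (p :: s) j && ~~ (p %| j)%N)
    j%:R^-1 <= euler_prod s.
  apply: le_trans (IHs s_pr); rewrite big_nat_cond [leRHS]big_nat_cond.
  rewrite [leLHS]big_mkcond [leRHS]big_mkcond; apply: ler_sum => j _.
  case: ifP => [/and3P[jN /allP js pj]|_]; last by case: ifP => // _.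
  rewrite jN ifT //=; apply/allP => q qj; have := js q qj; rewrite inE.
  by case: eqVneq qj pj => [->|//]; rewrite mem_primes => /and3P[_ _ ->].
(* Substitute [j = p * i]: [i] is again smooth for [p :: s], and dropping the condition [p * i <= N]
   only enlarges the sum. *)
have F_dvd : \sum_(1 <= j < N.+1 | smooth (p :: s) j && (p %| j)%N)
    j%:R^-1 <= p%:R^-1 * F.
  rewrite -big_filter.
  rewrite (perm_big (map (muln p) [seq i <- index_iota 1 N.+1 |
      smooth (p :: s) i && (p * i <= N)%N])).
    rewrite big_map big_filter mulr_sumr [leLHS]big_mkcond [leRHS]big_mkcond.
    apply: ler_sum => i _ /=; case: (smooth _ i) => //=; case: ifP => _.
      by rewrite natrM invfM.
    by rewrite mulr_ge0 // invr_ge0 ltW.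
  apply: uniq_perm; first by rewrite filter_uniq ?iota_uniq.
    rewrite map_inj_uniq ?filter_uniq ?iota_uniq // => x y /eqP.
    by rewrite eqn_pmul2l // => /eqP.
  have smoothM i : (0 < i)%N -> smooth (p :: s) (p * i)%N = smooth (p :: s) i.
    move=> i0; apply/allP/allP => H q qi.
      by apply: H; rewrite primesM // qi orbT.
    move: qi; rewrite primesM // primes_prime // inE.
    by case/orP => [/eqP ->|]; [rewrite /= inE eqxx | apply: H].
  move=> j; rewrite mem_filter mem_index_iota; apply/idP/mapP.
    move=> /andP[/andP[js /dvdnP[i ji]] /andP[j0 jN]].
    exists i; last by rewrite mulnC.
    have i0 : (0 < i)%N by move: j0; rewrite ji; case: (i).
    rewrite mem_filter mem_index_iota -smoothM // i0 mulnC -ji js -ltnS jN /=.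
    by rewrite (leq_ltn_trans _ jN) // ji leq_pmulr.
  move=> [i]; rewrite mem_filter mem_index_iota.
  move=> /andP[/andP[is_ piN] /andP[i0 _]] ->.
  by rewrite smoothM // is_ dvdn_mulr //= ltnS piN muln_gt0 p_gt0 i0.
have le_F : F <= p%:R^-1 * F + euler_prod s.
  by rewrite {1}/F (bigID (dvdn p)) /= lerD.
rewrite big_cons -/(euler_prod s) -/F /euler_factor.
have p1 : 0 < p.-1%:R :> R by rewrite ltr0n -ltnS prednK // prime_gt1.
have pE : p%:R = p.-1%:R + 1 :> R by rewrite natr1 prednK.
rewrite mulrAC ler_pdivlMr //.
have : p%:R * F <= F + p%:R * euler_prod s.
  apply: le_trans (ler_wpM2l (ltW p0) le_F) _.
  by rewrite mulrDr mulrA divff ?gt_eqF // mul1r.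
by rewrite {1}pE; lra.
Qed.

(** Each increment is [ln (1 + 1 / (N + 1)) <= 1 / (N + 1)]. *)
Lemma ln_le_harmonic (N : nat) :
  ln N.+1%:R <= \sum_(1 <= j < N.+1) j%:R^-1 :> R.
Proof.
elim: N => [|N IHN]; first by rewrite ln1 big_geq.
rewrite big_nat_recr //=.
have -> : N.+2%:R = N.+1%:R * (1 + N.+1%:R^-1) :> R.
  by rewrite mulrDr mulr1 divff ?pnatr_eq0 // -natr1.
rewrite lnM ?posrE ?addr_gt0 // lerD // le_ln1Dx //.
by rewrite (lt_trans _ (_ : 0 < _)) ?invr_gt0 // ltrN10.
Qed.

End EulerProduct.

(** * The set [A] and its loss against [E_k(n)] *)

Lemma prod_leq_exp (s : seq nat) (y : nat) :
  all (leq^~ y) s -> (\prod_(p <- s) p <= y ^ size s)%N.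
Proof.
elim: s => [|p s IHs] /=; first by rewrite big_nil.
by move=> /andP[py /IHs sy]; rewrite big_cons expnS leq_mul.
Qed.

Lemma E_set_has_prime_dvd (k n x : nat) : x \in E_set k n ->
  (x \in iota 1 n) && has (fun p => p %| x)%N (map ith_prime (iota 1 k)).
Proof. by rewrite !inE /= has_map. Qed.

Lemma all_prime_ith_prime (k : nat) : all prime (map ith_prime (iota 1 k)).
Proof.
by rewrite all_map; apply/allP => i; rewrite mem_iota => /andP[? _]; apply: prime_ith_prime.
Qed.

Section CoprimeFree.
Variables k n m : nat.
Hypotheses (k_gt0 : (0 < k)%N) (m_in : (0 < m <= n)%N).

Definition noncoprime_E : {fset nat} :=
  (m |` [fset x in E_set k n | ~~ coprime m x])%fset.

Lemma C_family_noncoprime_E : C_family k n noncoprime_E.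
Proof.
split.
  apply/fsubsetP => x; rewrite in_fset1U => /orP[/eqP ->|].
    by rewrite !inE mem_iota /= add1n ltnS.
  by rewrite !inE /= => /andP[/andP[]].
move=> [B [/fsubsetP BA cardB Bco]]; have [mB|mB] := boolP (m \in B).
  (* Since [k > 0], [B] has an element besides [m]; it would have to be both coprime and not coprime
     to [m]. *)
  have : (0 < #|` (B `\ m)%fset|%fset)%N.
    by move: cardB; rewrite (cardfsD1 m) mB add1n => -[->].
  rewrite cardfs_gt0 => /fset0Pn[x]; rewrite in_fsetD1 => /andP[xm xB].
  have := BA x xB; rewrite in_fset1U (negPf xm) /= !inE /= => /andP[_].
  by rewrite Bco // eq_sym.
suff : (#|` B|%fset <= k)%N by rewrite cardB ltnn.
rewrite -(size_iota 1 k) -(size_map ith_prime).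
apply: card_pairwise_coprime_le (all_prime_ith_prime k) _ Bco => x xB.
have := BA x xB; rewrite in_fset1U; case: eqVneq xB mB => [-> ->//|_ _ _ /=].
by rewrite !inE /= has_map => /andP[/andP[]].
Qed.

(** Every element of [E_set k n] missing from [noncoprime_E] is coprime to [m]. *)
Lemma card_noncoprime_E :
  (#|` E_set k n|%fset <=
    #|` noncoprime_E|%fset + count (coprime m) (iota 1 n))%N.
Proof.
pose N : {fset nat} := [fset x in [seq x <- iota 1 n | coprime m x]]%fset.
have EAN : (E_set k n `<=` noncoprime_E `|` N)%fset.
  apply/fsubsetP => x xE; rewrite in_fsetU in_fset1U.
  have -> : (x \in N) = coprime m x && (x \in iota 1 n).
    by rewrite /N inE /= mem_filter.
  have /andP[-> _] := E_set_has_prime_dvd _ _ _ xE.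
  have -> : (x \in [fset x in E_set k n | ~~ coprime m x]%fset) = ~~ coprime m x.
    by rewrite inE /= inE xE.
  by case: coprime; rewrite ?orbT.
apply: leq_trans (fsubset_leq_card EAN) _.
apply: leq_trans (leq_card_fsetU _ _) _; rewrite leq_add2l card_fseq.
by rewrite -size_filter size_undup.
Qed.

End CoprimeFree.

(** * Choice of [m] and the final estimate *)

Theorem theorem4 (R : realType) (k : nat) (hk : (0 < k)%N) :
  exists (K : R) (n0 : nat), 0 < K /\
    forall n : nat, (n0 <= n)%N ->
      exists A : {fset nat},
        [/\ C_family k n A,
            ~ (A `<=` E_set k n)%fset
          & (#|` E_set k n|%fset)%:R - (#|` A|%fset)%:R
              <= K * (n%:R / ln (ln n%:R))].
Proof.
pose t := map ith_prime (iota 1 k).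
have t_pr : all prime t := all_prime_ith_prime k.
have D_gt0 : 0 < euler_prod R t by apply: euler_prod_gt0.
(* One factor 2 comes from [count_coprime_le], the other from [lnln_y]; the Euler product over [t]
   pays for omitting the first [k] primes from [m]. The threshold forces [n > e], so that
   [ln (ln n) > 0]. *)
exists (4 * euler_prod R t), (Num.bound (expR 1 : R)).
split; first by rewrite mulr_gt0.
move=> n n0n.
have e_lt_n : expR 1 < n%:R :> R.
  by apply: lt_le_trans (archi_boundP (expR_ge0 _)) _; rewrite ler_nat.
have nR_gt0 : 0 < n%:R :> R by apply: lt_trans e_lt_n; rewrite expR_gt0.
have n_gt0 : (0 < n)%N by rewrite ltr0n in nR_gt0.
have ln_gt1 : 1 < ln n%:R :> R by rewrite -ltr_expR lnK.
have lnn_gt0 : 0 < ln n%:R :> R := lt_trans ltr01 ln_gt1.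
have lnln_gt0 : 0 < ln (ln n%:R) :> R by rewrite ln_gt0.
(* The witness uses the convention [0 ^ 0 = 1]. *)
have ex_y : exists y, (y ^ y <= n)%N by exists 0%N.
have y_le y : (y ^ y <= n)%N -> (y <= n)%N.
  by case: y => // y; apply: leq_trans; rewrite -{1}[y.+1]expn1 leq_pexp2l.
case: (ex_maxnP ex_y y_le) => y yn y_max.
pose s := [seq p <- iota 1 y | prime p && (p \notin t)].
pose m := (\prod_(p <- s) p)%N.
have s_pr : all prime s by apply/allP => p; rewrite mem_filter => /andP[/andP[]].
have s_uniq : uniq s by rewrite filter_uniq ?iota_uniq.
have m_gt0 : (0 < m)%N.
  by rewrite /m big_seq prodn_cond_gt0 // => p /(allP s_pr)/prime_gt0.
(* [m] is a product of at most [y] factors, each at most [y], so [m <= y ^ y]. *)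
have m_le : (m <= n)%N.
  apply: leq_trans yn; apply: (@leq_trans (y ^ size s)).
    apply: prod_leq_exp; apply/allP => p; rewrite mem_filter mem_iota add1n ltnS.
    by move=> /and3P[].
  have [y0|y_gt0] := posnP y; first by rewrite /s y0.
  by rewrite leq_pexp2l // size_filter (leq_trans (count_size _ _)) // size_iota.
have m_in : (0 < m <= n)%N by rewrite m_gt0.
exists (noncoprime_E k n m); split.
- exact: C_family_noncoprime_E.
- move=> /fsubsetP/(_ m); rewrite in_fset1U eqxx => /(_ isT) /E_set_has_prime_dvd.
  move=> /andP[_ /hasP[p pt /prime_dvd_prod_mem]].
  rewrite (allP t_pr) // s_pr mem_filter => /(_ isT isT).
  by rewrite -/t pt andbF.
have ln_y : ln y.+1%:R <= euler_prod R (t ++ s).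
  apply: le_trans (ln_le_harmonic R y) _.
  have := @smooth_harmonic_le R (t ++ s) y.
  rewrite all_cat t_pr s_pr => /(_ isT); apply: le_trans.
  (* The two sums coincide: every prime factor of some [j <= y] lies in [t] or in [s]. *)
  rewrite big_nat_cond [leRHS]big_nat_cond le_eqVlt; apply/orP; left.
  apply/eqP; apply: eq_bigl => j; rewrite andbT.
  case: (boolP (0 < j < y.+1)%N) => //= /andP[j_gt0 jy].
  apply/esym/allP => p; rewrite mem_primes => /and3P[p_pr _ pj].
  rewrite /= mem_cat mem_filter p_pr mem_iota prime_gt0 // add1n.
  by rewrite (leq_ltn_trans (dvdn_leq _ pj)) //; case: (p \in t).
have lnln_y : ln (ln n%:R) <= 2 * ln y.+1%:R :> R.
  have y1_gt0 : 0 < y.+1%:R :> R by rewrite ltr0n.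
  have n_lt : n%:R <= y.+1%:R ^+ y.+1 :> R.
    rewrite -natrX ler_nat ltnW // ltnNge; apply/negP => /y_max.
    by rewrite ltnn.
  (* By maximality of [y], [ln n <= (y + 1) * ln (y + 1)], and [ln (y + 1) < y + 1]. *)
  have ln_n_le : ln n%:R <= y.+1%:R ^+ 2 :> R.
    apply: (@le_trans _ _ (ln (y.+1%:R ^+ y.+1))).
      by rewrite ler_ln ?posrE // exprn_gt0.
    rewrite lnXn // -[ln _ *+ _]mulr_natl expr2; apply: ler_wpM2l => //; apply: ltW.
    by rewrite -ltr_expR lnK ?posrE // (lt_le_trans _ (expR_ge1Dx _)) // ltrDr.
  have := ln_n_le; rewrite -ler_ln ?posrE ?exprn_gt0 //.
  by rewrite lnXn // mulr_natl.
set c := count (coprime m) (iota 1 n).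
have loss_le : (#|` E_set k n|%fset)%:R - (#|` noncoprime_E k n m|%fset)%:R <= c%:R :> R.
  by rewrite lerBlDl -natrD ler_nat card_noncoprime_E.
apply: (le_trans loss_le); rewrite mulrA ler_pdivlMr //.
have phi_gt0 : 0 < (totient m)%:R :> R by rewrite ltr0n totient_gt0.
have euler_s := totient_euler_prod R _ s_pr s_uniq; rewrite -/m in euler_s.
have euler_ts : euler_prod R (t ++ s) = euler_prod R t * euler_prod R s.
  by rewrite /euler_prod big_cat.
have c_le : c%:R * m%:R <= 2 * n%:R * (totient m)%:R :> R.
  by rewrite -!natrM ler_nat count_coprime_le.
(* Replace [m] by [phi(m)] times its Euler product in [c_le], then cancel [phi(m)]. *)
have c_euler : c%:R * euler_prod R s <= 2 * n%:R.
  by rewrite -(ler_pM2r phi_gt0) -mulrA [euler_prod _ _ * _]mulrC euler_s.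
have L_le : ln (ln n%:R) <= 2 * (euler_prod R t * euler_prod R s).
  by rewrite -euler_ts (le_trans lnln_y) // ler_pM2l.
apply: le_trans (ler_wpM2l (ler0n _ c) L_le) _.
have := ler_wpM2l (ltW D_gt0) c_euler; lra.
Qed.
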